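(* For every $n\ge 1$ the genus distribution of ${\cal S}_4^n$ is log-concave. If $n=3$ its modes are $1$ and $2$; for every other $n\ge 1$ it has the single mode $$p_4(n)=\Big[\frac{n}{3}\Big]+1.$$
   Context: $[x]$ denotes the largest integer not exceeding $x$. A surface is represented by a cyclic word in which every occurring letter $x$ appears exactly once as $x$ and exactly once as $x^-$; it is the closed orientable surface obtained from a polygon with boundary labelled by the word by identifying each side $x$ with the side $x^-$ (orientation reversed), and its genus is the genus of that surface. Let $a,a_1,a_2,\dots$ be distinct letters. For $n\ge 1$ and subsets $K,T\subseteq\{1,\dots,n\}$ put: $R_1^n$ = product of the letters $a_k$, $k\in K$, in decreasing order of index; $R_2^n$ = product of the $a_k$, $k\notin K$, in increasing order of index; $R_3^n$ = product of the $a_t^-$, $t\in T$, in decreasing order of index; $R_4^n$ = product of the $a_t^-$, $t\notin T$, in increasing order of index. The set of ladder surfaces considered is ${\cal S}_4^n=\{aR_1^nR_2^na^-R_3^nR_4^n\}$, where $(K,T)$ runs over all $4^n$ pairs of subsets and surfaces are counted with multiplicity (one for each pair). The genus distribution of ${\cal S}_4^n$ is the sequence $(g_{i_4}(n))_i$, where $g_{i_4}(n)$ is the number of surfaces of genus $i$ in ${\cal S}_4^n$ and $i$ runs from the minimum to the maximum genus. A finite sequence of nonnegative numbers is log-concave if $a_i^2\ge a_{i-1}a_{i+1}$ for all interior indices $i$. It is unimodal if $a_q\le\cdots\le a_{l-1}<a_l=\cdots=a_m>a_{m+1}\ge\cdots\ge a_n$ for some $q\le l\le m\le n$; the indices $l,\dots,m$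 (genera) are its modes. *)

(* Defs.v *)
From mathcomp Require Import all_boot all_order all_algebra.

Set Implicit Arguments.
Unset Strict Implicit.
Unset Printing Implicit Defensive.

Import Order.TTheory GRing.Theory Num.Theory.

Section Words.
Variable L : eqType.

(* (x, true) is the letter x and (x, false) is its inverse x^-; a word is
   implicitly cyclic, since it is only read around the boundary of a polygon. *)
Definition sletter := (L * bool)%type.

Definition inv_letter (s : sletter) : sletter := (s.1, ~~ s.2).

Definition letters (w : seq sletter) : seq L := undup [seq s.1 | s <- w].

Definition surface_word (w : seq sletter) : bool :=
  all (fun x => (count_mem (x, true) w == 1%N) &&
                (count_mem (x, false) w == 1%N)) (letters w).

Definition glued (w : seq sletter) (i j : 'I_(size w)) : bool :=
  tnth (in_tuple w) j == inv_letter (tnth (in_tuple w) i).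

(* Side i of the polygon runs from corner i to corner i + 1 (cyclically).  As
   the gluing of sides i and j reverses orientation, it identifies the start of
   i with the end of j and the end of i with the start of j. *)
Definition corner_glued (w : seq sletter) : rel 'I_(size w) :=
  [rel u v | [exists i, exists j, glued i j &&
     (((u == i) && (v == ordS j)) || ((u == ordS i) && (v == j)))]].

Definition nb_vertices (w : seq sletter) : nat :=
  n_comp (@corner_glued w) predT.

Definition nb_edges (w : seq sletter) : nat := size (letters w).

(* The cell structure induced by the polygon has exactly one face. *)
Definition euler_char (w : seq sletter) : int :=
  ((nb_vertices w)%:Z - (nb_edges w)%:Z + 1)%R.

Definition has_genus (w : seq sletter) (g : nat) : bool :=
  (euler_char w == 2 - 2 * g%:Z)%R.

End Words.

(* The letter None stands for a, and Some k, with k : 'I_n, stands for a_(k+1).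
   Note that enum lists a set of ordinals in increasing order. *)
Definition ladder (n : nat) (K T : {set 'I_n}) : seq (sletter (option 'I_n)) :=
  (None, true) :: [seq (Some k, true) | k <- rev (enum K)]
    ++ [seq (Some k, true) | k <- enum (~: K)]
    ++ (None, false) :: [seq (Some t, false) | t <- rev (enum T)]
    ++ [seq (Some t, false) | t <- enum (~: T)].

Lemma ladder_surface_word n (K T : {set 'I_n}) : surface_word (ladder K T).
Proof.
have inj (b : bool) : injective (fun i : 'I_n => (Some i, b)) by move=> i j [].
have cS (b : bool) (A : {set 'I_n}) k : count_mem (Some k, b)
    [seq (Some i, b) | i <- enum A] = (k \in A).
  rewrite count_uniq_mem ?(map_inj_uniq (@inj b)) ?enum_uniq //.
  by rewrite (mem_map (@inj b)) mem_enum.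
have c0 (x : option 'I_n) (b c : bool) (s : seq 'I_n) :
    (b != c) || (x == None) -> count_mem (x, b) [seq (Some i, c) | i <- s] = 0.
  move=> h; apply/count_memPn/negP => /mapP[i _ [ex eb]].
  by rewrite ex eb eqxx in h.
apply/allP => -[k|] _; rewrite /ladder /= !count_cat /= !count_cat /= !map_rev.
  rewrite !count_rev !cS !(c0 _ true false) ?(c0 _ false true) // !in_setC.
  by case: (k \in K); case: (k \in T).
by rewrite !count_rev !c0 ?orbT.
Qed.

Definition genus_count (n i : nat) : nat :=
  #|[set KT : {set 'I_n} * {set 'I_n} | has_genus (ladder KT.1 KT.2) i]|.

(* q and r are the least and the greatest genus occurring in the family. *)
Definition genus_range (n q r : nat) : Prop :=
  [/\ 0 < genus_count n q, 0 < genus_count n r &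
      forall i, 0 < genus_count n i -> q <= i <= r].

Definition log_concave (q r : nat) (f : nat -> nat) : Prop :=
  forall i, q < i < r -> f i.-1 * f i.+1 <= f i ^ 2.

(* f q <= ... <= f (l - 1) < f l = ... = f m > f (m + 1) >= ... >= f r; the
   strict inequalities are void when l = q, respectively m = r. *)
Definition unimodal_with_modes (q r l m : nat) (f : nat -> nat) : Prop :=
  [/\ [&& q <= l, l <= m & m <= r],
      forall i, q <= i -> i.+1 < l -> f i <= f i.+1,
      q < l -> f l.-1 < f l,
      forall i, l <= i <= m -> f i = f l &
      (m < r -> f m.+1 < f m) /\
      (forall i, m < i -> i < r -> f i.+1 <= f i)].

(* Main.v *)
(** The vertices of a glued polygon are the cycles of the permutation [inv; next]
    of its signed letters, where [next] is the cyclic word.  Gluing first the side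
    [a] of the word [a W a^- V] splits the polygon into [W] and [V], and gluing
    next a side [b] common to [b C] and [b^- E] joins them into [C E]; each step
    changes the number of cycles in a controlled way.

    In [a R1 R2 a^- R3 R4] the letter of largest index [k] is extremal both in
    [R1 R2] and in [R3 R4], and gluing [a] and then [a_k] removes both and leaves
    the word [R1 R2 R3 R4] on the smaller letters, with one genus less.  In that
    word the letter of largest index [k] cancels when exactly one of [k \in K] and
    [k \in T] holds, and otherwise plays the role of [a].  Hence the genus
    depends only on the set [C] of the [k] on which [K] and [T] agree, and the number
    [u m g] of surfaces of genus [g + 1], for [m = n - 1] and up to the factor
    [2 ^ (n + 1)], satisfies [u m g = u (m - 1) g + 2 u (m - 2) (g - 1)].  This has
    the solution [u m g = 2 ^ g * (m - g - 1)! (2 m - 3 g) / (g! (m - 2 g)!)], whose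
    ratio of consecutive terms is decreasing in [g] and crosses [1] at the mode. *)

Require Import Defs.
From mathcomp Require Import all_boot all_fingroup zify ring.

Set Implicit Arguments.
Unset Strict Implicit.
Unset Printing Implicit Defensive.

Local Open Scope group_scope.

(** * Cyclic permutations *)

(** Products of permutations are read from left to right, so on a duplicate-free list this product
    of transpositions sends each entry to the next one, cyclically. *)
Definition cyc (T : finType) (s : seq T) : {perm T} :=
  if s is x :: s' then \prod_(y <- s') tperm x y else 1.

Arguments cyc : simpl never.

Section CyclicPermutations.
Variable T : finType.
Implicit Types (x y z : T) (s : seq T) (f : {perm T}).

(** The transposition inserts the fixed point [x] right before [y] in the cycle of [y], so the cycle
    formed by [x] alone disappears unless [x = y]. *)
Lemma card_porbits_attach f x y :
  f x = x -> (#|porbits (f * tperm x y)| + (x != y) = #|porbits f|)%N.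
Proof.
move=> fx; have [<-|xy] := eqVneq; first by rewrite tperm1 mulg1 addn0.
have fVx : f^-1 x = x by rewrite -{1}fx permK.
have -> : f * tperm x y = tperm x (f^-1 y) * f.
  by rewrite -{2}fVx -tpermJ conjgE invgK -!mulgA mulVg mulg1.
have := porbits_mul_tperm f x (f^-1 y).
have -> : x \notin porbit f (f^-1 y).
  rewrite porbit_sym; apply/negP => /porbitP[i /(congr1 f)].
  rewrite permKV => def_y; case/eqP: xy; rewrite def_y.
  have fix_x : (f ^+ i) x = x.
    by elim: i {def_y} => [|i IH]; rewrite ?expg0 ?perm1 // expgS permM fx.
  by rewrite fix_x fx.
have -> : x != f^-1 y by apply: contraNneq xy => e; rewrite -[y](permKV f) -e fx.
by rewrite /= !addn1 addn2 => -[].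
Qed.

(** Moving [tperm x y] to the right conjugates the remaining transpositions, which replaces their
    pivot [x] by [y]. *)
Lemma cyc_cons2 x y s :
  uniq [:: x, y & s] -> cyc [:: x, y & s] = cyc (y :: s) * tperm x y.
Proof.
move=> /= /and3P[]; rewrite inE negb_or => /andP[xy xs] ys _.
rewrite /cyc big_cons.
suff <- : (\prod_(z <- s) tperm x z) ^ tperm x y = \prod_(z <- s) tperm y z.
  by rewrite conjgE tpermV -!mulgA tperm2 mulg1.
elim: s xs ys => [|z s IH]; first by rewrite !big_nil conj1g.
rewrite !inE !negb_or => /andP[xz xs] /andP[yz ys].
by rewrite !big_cons conjMg IH // tpermJ tpermL tpermD.
Qed.

Lemma cyc1 x : cyc [:: x] = 1.
Proof. exact: big_nil. Qed.

Lemma cyc_cons x s : uniq (x :: s) -> cyc (x :: s) = cyc s * tperm x (head x s).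
Proof.
by case: s => [|y s /cyc_cons2] //; rewrite cyc1 tperm1 mulg1.
Qed.

Lemma cyc_rcons x s : uniq (x :: s) -> cyc (rcons s x) = cyc (x :: s).
Proof.
case: s => // y s /cyc_cons2->.
by rewrite /cyc /= -cats1 big_cat big_seq1 tpermC.
Qed.

Lemma cyc_cat x s y t :
  uniq (x :: s ++ y :: t) ->
  cyc (x :: s ++ y :: t) = cyc (x :: s) * cyc (y :: t) * tperm x y.
Proof.
move=> u; have u2 : uniq [:: x, y & t].
  by apply: subseq_uniq u; rewrite /= eqxx suffix_subseq.
by rewrite -mulgA -(cyc_cons2 u2) /cyc big_cat.
Qed.

Lemma cyc_out s x : x \notin s -> cyc s x = x.
Proof.
rewrite /cyc; case: s => [|y s]; first by rewrite perm1.
rewrite inE negb_or => /andP[yx]; elim: s => [|z s IH]; first by rewrite big_nil perm1.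
rewrite inE negb_or big_cons permM => /andP[zx xs].
by rewrite tpermD ?IH // eq_sym.
Qed.

Lemma cyc_in s x : x \in s -> cyc s x \in s.
Proof.
move=> xs; have [//|nxs] := boolP (cyc s x \in s).
by case/negP: (nxs); rewrite (perm_inj (cyc_out nxs)).
Qed.

Lemma cyc_comm s t : uniq (s ++ t) -> cyc s * cyc t = cyc t * cyc s.
Proof.
rewrite cat_uniq => /and3P[_ /hasPn st _].
have ts z : z \in s -> z \notin t by move=> zs; apply/negP => /st /=; rewrite zs.
apply/permP => x; rewrite !permM.
have [xs|xs] := boolP (x \in s); first by rewrite !(@cyc_out t) ?ts ?cyc_in.
have [xt|xt] := boolP (x \in t); last by rewrite !cyc_out.
by rewrite (cyc_out xs) (@cyc_out s) //; exact: (st _ (cyc_in xt)).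
Qed.

Lemma cyc_cons_mul x s y t : uniq (x :: s ++ y :: t) ->
  cyc (x :: s) * cyc (y :: t) =
  cyc s * cyc t * tperm x (head x s) * tperm y (head y t).
Proof.
rewrite /= cat_uniq mem_cat inE !negb_or => /and5P[/and3P[xs _ xt] us].
move=> /andP[_ st] yt ut.
have uxs : uniq (x :: s) by rewrite /= xs.
have uyt : uniq (y :: t) by rewrite /= yt.
have ust : uniq (s ++ t) by rewrite cat_uniq us st.
rewrite (cyc_cons uyt) mulgA (@cyc_comm (x :: s) t) /= ?mem_cat ?negb_or ?xs ?xt //.
by rewrite (cyc_cons uxs) mulgA -(cyc_comm ust).
Qed.

Lemma neq_head x s : x \notin s -> (x != head x s) = (s != [::]).
Proof. by case: s => [|y s] /=; rewrite ?eqxx // inE negb_or => /andP[->]. Qed.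

Lemma tperm_head x y s :
  x \notin s -> y \notin s -> tperm x y (head x s) = head y s.
Proof.
case: s => [|z s]; rewrite ?tpermL //= !inE !negb_or.
by move=> /andP[? _] /andP[? _]; rewrite tpermD.
Qed.

End CyclicPermutations.

(** * Effect of gluing a pair of sides on the number of cycles *)

Section Gluing.
Variables (T : finType) (iota : {perm T}).
Implicit Types (a b x : T) (s t C E V W : seq T).

Definition nb_cycles (f : {perm T}) := #|porbits (iota * f)|.

(** In [iota * (cyc W * cyc V)] the points [a] and [a'] form a two-cycle. It is cut into two fixed
    points, and each of these is attached to the head of [V] or [W], at the cost of one cycle if
    that word is nonempty. *)
Lemma nb_cycles_split a W a' V :
    iota a = a' -> iota a' = a -> uniq (a :: W ++ a' :: V) ->
  ((nb_cycles (cyc (a :: W ++ a' :: V))).+1 =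
   nb_cycles (cyc W * cyc V) + (W == [::]) + (V == [::]))%N.
Proof.
move=> ia ia' u; rewrite cyc_cat // cyc_cons_mul //; move: u.
rewrite /= cat_uniq mem_cat inE !negb_or => /and5P[/and3P[aW aa' aV] _].
move=> /andP[a'W _] a'V _.
set tau := cyc W * cyc V; pose g := iota * tau * tperm a a'.
have ga : g a = a by rewrite !permM ia (cyc_out a'W) (cyc_out a'V) tpermR.
have ga' : g a' = a' by rewrite !permM ia' (cyc_out aW) (cyc_out aV) tpermL.
(* Conjugation brings [tperm a a'] next to [tau], so that each of the other two transpositions
   attaches a fixed point. *)
have -> : tau * tperm a (head a W) * tperm a' (head a' V) * tperm a a'
        = tau * tperm a a' * tperm a' (head a' W) * tperm a (head a V).
  rewrite -!(mulgA tau); congr (tau * _); rewrite -mulgA.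
  rewrite (conjgC (tperm a' _)) mulgA (conjgC (tperm a _)) !tpermJ.
  by rewrite tperm_head // tpermL tpermR tpermC tperm_head.
rewrite /nb_cycles !mulgA -(mulgA iota) -/tau -/g.
have := card_porbits_attach (head a' W) ga'; rewrite neq_head //.
have gWa : (g * tperm a' (head a' W)) a = a.
  rewrite permM ga tpermD // 1?eq_sym //.
  by case: (W) aW => //= w W'; rewrite inE negb_or => /andP[].
have := card_porbits_attach (head a V) gWa; rewrite neq_head //.
have := card_porbits_attach a' ga; rewrite aa' -(mulgA _ (tperm a a')) tperm2 mulg1.
suff arith (A B G I : nat) (v w : bool) :
  (I + true = G -> A + ~~ v = B -> B + ~~ w = G -> A.+1 = I + w + v)%N by exact: arith.
lia.
Qed.

(** The two-cycle of [b] and [b'] is merged with the cycle through the head of [C]. This serves the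
    case of [nb_cycles_join] where one of the words is empty. *)
Lemma nb_cycles_cons b C b' :
    iota b = b' -> iota b' = b -> b != b' -> uniq (b :: C) -> b' \notin C ->
  (nb_cycles (cyc (b :: C)) + (C != [::]) = nb_cycles (cyc C))%N.
Proof.
move=> ib ib' bb' u b'C; rewrite cyc_cons //; case/andP: u => bC _.
pose g := iota * cyc C * tperm b b'.
have gb : g b = b by rewrite !permM ib (cyc_out b'C) tpermR.
have gb' : g b' = b' by rewrite !permM ib' (cyc_out bC) tpermL.
have gt : g * tperm b b' = iota * cyc C by rewrite -mulgA tperm2 mulg1.
have gCb : (g * tperm b' (head b' C)) b = b.
  rewrite permM gb tpermD // 1?eq_sym //.
  by case: (C) bC => //= c C'; rewrite inE negb_or => /andP[].
have := card_porbits_attach b' gb; rewrite bb' gt.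
have := card_porbits_attach (head b' C) gb'; rewrite neq_head //.
have := card_porbits_attach b' gCb; rewrite bb' -mulgA (conjgC (tperm b' _)).
have -> : (tperm b' (head b' C)) ^ tperm b b' = tperm b (head b C).
  by rewrite tpermJ tpermR [tperm b b']tpermC tperm_head.
rewrite mulgA gt /nb_cycles -mulgA.
suff arith (A B G I : nat) (v : bool) :
  (A + true = B -> B + v = G -> I + true = G -> A + v = I)%N by exact: arith.
lia.
Qed.

(** Both permutations come from [h], which fixes [b] and [b']: joining these two points to each
    other costs one cycle, attaching them to [e] and [c] costs two. *)
Lemma nb_cycles_merge (tau : {perm T}) b b' c e :
    iota b = b' -> iota b' = b -> tau b = b -> tau b' = b' ->
    uniq [:: b; b'; c; e] ->
  (nb_cycles (tau * tperm b c * tperm b' e)).+1 = nb_cycles (tau * tperm c e).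
Proof.
move=> ib ib' tb tb'.
rewrite /= !inE !negb_or !andbT => /and3P[/and3P[bb' bc be] /andP[b'c b'e] ce].
pose h := iota * tau * tperm c e * tperm b b'.
have hb : h b = b.
  by rewrite !permM ib tb' [tperm c e _]tpermD 1?eq_sym // tpermR.
have hb' : h b' = b'.
  by rewrite !permM ib' tb [tperm c e _]tpermD 1?eq_sym // tpermL.
have hbe : (h * tperm b e) b' = b'.
  by rewrite permM hb' tpermD // eq_sym.
have := card_porbits_attach c hbe; have := card_porbits_attach e hb.
have := card_porbits_attach b' hb.
have -> : h * tperm b b' = iota * tau * tperm c e by rewrite -mulgA tperm2 mulg1.
have -> : h * tperm b e * tperm b' c = iota * tau * tperm b c * tperm b' e.
  rewrite /h -!mulgA; congr (_ * (_ * _)).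
  have ns (x y : T) : x != y -> y != x by rewrite eq_sym.
  have [[b'b cb] eb] := (ns _ _ bb', ns _ _ bc, ns _ _ be).
  have [[cb' eb'] ec] := (ns _ _ b'c, ns _ _ b'e, ns _ _ ce).
  apply/permP => x; rewrite !permM.
  pose D := (tpermL, tpermR, tpermD cb eb, tpermD cb' eb', tpermD bc b'c, tpermD be b'e,
    tpermD bb' eb', tpermD bc ec, tpermD b'b cb, tpermD b'e ce, tpermD bb' cb',
    tpermD be ce, tpermD b'b eb, tpermD b'c ec).
  have [<-|xb] := eqVneq b x; first by rewrite !D.
  have [<-|xb'] := eqVneq b' x; first by rewrite !D.
  have [<-|xc] := eqVneq c x; first by rewrite !D.
  have [<-|xe] := eqVneq e x; first by rewrite !D.
  by rewrite !tpermD.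
rewrite /nb_cycles !mulgA bb' be b'c.
suff arith (A B I H : nat) :
  (I + true = H -> B + true = H -> A + true = B -> A.+1 = I)%N by exact: arith.
lia.
Qed.

(** Gluing two discs along [b] keeps the vertices; the additional cycle is [b, b'] itself, whose
    letter has become absent. *)
Lemma nb_cycles_join b C b' E :
    iota b = b' -> iota b' = b -> uniq (b :: C ++ b' :: E) ->
  ((nb_cycles (cyc (b :: C) * cyc (b' :: E))).+1 =
   nb_cycles (cyc (C ++ E)) + (C ++ E == [::]))%N.
Proof.
move=> ib ib' u; have := u.
rewrite /= cat_uniq mem_cat inE !negb_or => /and5P[/and3P[bC bb' bE] uC].
move=> /andP[b'C _] b'E uE.
have ubC : uniq (b :: C) by rewrite /= bC.
have ub'E : uniq (b' :: E) by rewrite /= b'E.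
have uCE : uniq (C ++ E).
  apply: subseq_uniq u; apply: subseq_trans (subseq_cons _ b).
  exact: cat_subseq (subseq_refl C) (subseq_cons E b').
have [C0|C0] := eqVneq C [::].
  rewrite C0 cyc1 mul1g /=.
  have b'b : b' != b by rewrite eq_sym.
  rewrite -(nb_cycles_cons ib' ib b'b ub'E bE) -addnA.
  by case: eqP; rewrite ?addn1.
have [E0|E0] := eqVneq E [::].
  rewrite E0 cats0 cyc1 mulg1 (negPf C0).
  by rewrite -(nb_cycles_cons ib ib' bb' ubC b'C) C0 addn1 addn0.
rewrite cyc_cons_mul //.
case: C C0 E E0 bC b'C bE b'E ubC ub'E uCE {u uC uE} => // c C _ [] // e E _.
rewrite !inE !negb_or => /andP[bc bC] /andP[b'c b'C] /andP[be bE] /andP[b'e b'E].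
move=> ubC ub'E uCE; rewrite (cyc_cat uCE) addn0.
have ec : e != c.
  by move: uCE; rewrite /= mem_cat inE !negb_or eq_sym => /andP[/and3P[]].
have tauE x : x \notin c :: C -> x \notin e :: E -> (cyc (c :: C) * cyc (e :: E)) x = x.
  by move=> xC xE; rewrite permM (cyc_out xC) (cyc_out xE).
rewrite (nb_cycles_merge ib ib') ?[head _ _]/=.
- by [].
- by apply: tauE; rewrite inE negb_or ?bc ?be.
- by apply: tauE; rewrite inE negb_or ?b'c ?b'e.
by rewrite /= !inE !negb_or bb' bc be b'c b'e eq_sym ec.
Qed.

End Gluing.

(** * Weights of words *)

Lemma inv_letterK (L : eqType) : involutive (@inv_letter L).
Proof. by case=> x b; rewrite /inv_letter /= negbK. Qed.

Section Weight.
Variable L : finType.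
Implicit Types (a b x : sletter L) (w s t C E V W : seq (sletter L)).

Definition inv_perm : {perm sletter L} := perm (can_inj (@inv_letterK L)).

Lemma inv_permE x : inv_perm x = inv_letter x.
Proof. exact: permE. Qed.

(* For a word closed under [inv_letter], this is its number of vertices plus the
   number of letters that do not occur in it, as an absent letter [x] forms the
   cycle [x, x^-].  The empty word stands for a sphere with a single vertex. *)
Definition weight w := (nb_cycles inv_perm (cyc w) + (w == [::]))%N.

Definition ext (p : bool) x s := if p then x :: s else rcons s x.

Lemma perm_ext p x s : perm_eq (ext p x s) (x :: s).
Proof. by case: p; rewrite //= perm_rcons. Qed.

Lemma cyc_ext p x s : uniq (x :: s) -> cyc (ext p x s) = cyc (x :: s).
Proof. by case: p => // /cyc_rcons. Qed.

Lemma weight_rot s t : uniq (s ++ t) -> weight (s ++ t) = weight (t ++ s).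
Proof.
elim: s t => [|x s IH] t; first by rewrite cats0.
move=> u; have uxst : uniq (x :: s ++ t) by [].
have -> : weight ((x :: s) ++ t) = weight (s ++ rcons t x).
  rewrite -rcons_cat /weight (cyc_rcons uxst) /=.
  by case: (s ++ t).
by rewrite IH -?rcons_cat ?rcons_uniq // cat_rcons.
Qed.

Lemma weight_cancel x s : uniq [:: x, inv_letter x & s] ->
  weight [:: x, inv_letter x & s] = weight s.
Proof.
move=> u; have := @nb_cycles_split _ inv_perm x [::] (inv_letter x) s.
rewrite !inv_permE inv_letterK => /(_ erefl erefl u).
by rewrite [cyc [::]]/cyc mul1g /weight eqxx addn0 addn1 => -[].
Qed.

(** Gluing [a] separates two discs, one with [b] and one with its inverse, each at an end and so
    movable to the front by rotation; gluing [b] joins the discs again. Each of the two steps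
    accounts for one unit. *)
Lemma weight_handle a b p q C E :
  uniq (a :: ext p b C ++ inv_letter a :: ext q (inv_letter b) E) ->
  ((weight (a :: ext p b C ++ inv_letter a :: ext q (inv_letter b) E)).+2 =
   weight (C ++ E))%N.
Proof.
move=> u; have ubCE : uniq (b :: C ++ inv_letter b :: E).
  have : uniq (a :: (b :: C) ++ inv_letter a :: inv_letter b :: E).
    suff /perm_uniq <- :
      perm_eq (a :: ext p b C ++ inv_letter a :: ext q (inv_letter b) E)
              (a :: (b :: C) ++ inv_letter a :: inv_letter b :: E) by [].
    by rewrite perm_cons perm_cat ?perm_cons ?perm_ext.
  apply: subseq_uniq; apply: subseq_trans (subseq_cons _ a).
  exact: cat_subseq (subseq_refl (b :: C)) (subseq_cons _ (inv_letter a)).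
have ubC : uniq (b :: C).
  by apply: subseq_uniq ubCE; exact: (prefix_subseq (b :: C)).
have ubE : uniq (inv_letter b :: E).
  by apply: subseq_uniq ubCE; exact: (suffix_subseq (b :: C)).
have ext0 r x s : (ext r x s == [::]) = false by case: r => //=; case: s.
have := nb_cycles_split (iota := inv_perm) _ _ u.
have := nb_cycles_join (iota := inv_perm) _ _ ubCE.
rewrite !inv_permE !inv_letterK => /(_ erefl erefl) join /(_ erefl erefl).
rewrite !cyc_ext // !ext0 !addn0 /weight /= addn0 => ->; exact: join.
Qed.

End Weight.

(** * Weight of the words [R_1 R_2 R_3 R_4], with or without an enclosing letter *)

Section Sides.
Variable I : finType.
Implicit Types (s : seq I) (K T : {set I}).

(** For [s] in decreasing order of index this is [R_1 R_2] or [R_3 R_4], built from the inside out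
    so that the head of [s] sits at an end. *)
Fixpoint side K (e : bool) s : seq (sletter (option I)) :=
  if s is k :: s' then ext (k \in K) (Some k, e) (side K e s') else [::].

Lemma side_filter K e s :
  side K e s = [seq (Some k, e) | k <- [seq k <- s | k \in K]]
    ++ [seq (Some k, e) | k <- rev [seq k <- s | k \notin K]].
Proof.
elim: s => //= k s ->; rewrite /ext; case: (k \in K) => //=.
by rewrite rev_cons map_rcons rcons_cat.
Qed.

Lemma perm_side K e s : perm_eq (side K e s) [seq (Some k, e) | k <- s].
Proof.
elim: s => //= k s IH; apply: perm_trans (perm_ext _ _ _) _.
by rewrite perm_cons.
Qed.

(* Half the rank over F_2 of the adjacency matrix of the interlacement graph of
   [side K true s ++ side T false s], where [C] is the set on which [K] and [T]
   agree: in this threshold graph, [k \in C] is adjacent to all the letters that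
   follow it in [s], and the others to none of them. *)
Fixpoint thr_genus (C : {set I}) s : nat :=
  if s is k :: s' then
    if k \in C then (if s' is _ :: s'' then (thr_genus C s'').+1 else 0)
    else thr_genus C s'
  else 0.

(* The same for the word in which a further letter encloses the two sides: its
   vertex is adjacent to all others. *)
Definition cone_genus (C : {set I}) s : nat :=
  if s is _ :: s' then (thr_genus C s').+1 else 0.

Definition agree K T : {set I} := [set k | (k \in K) == (k \in T)].

Lemma uniq_cone (x : sletter (option I)) K T s : x.1 \notin map Some s -> uniq s ->
  uniq (x :: side K true s ++ inv_letter x :: side T false s).
Proof.
move=> xs us; have sides e : uniq [seq (Some k, e) | k <- s].
  by rewrite map_inj_uniq // => i j [].
have xside y e : y.1 = x.1 -> y \notin [seq (Some k, e) | k <- s].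
  move=> yx; apply: contra xs => /mapP[k ks def_y].
  by rewrite -yx def_y; exact: (map_f Some ks).
have /perm_uniq -> :
    perm_eq (x :: side K true s ++ inv_letter x :: side T false s)
            (x :: [seq (Some k, true) | k <- s] ++
             inv_letter x :: [seq (Some k, false) | k <- s]).
  by rewrite perm_cons perm_cat ?perm_cons ?perm_side.
rewrite cons_uniq mem_cat inE !negb_or !xside // cat_uniq cons_uniq !sides xside //=.
rewrite andbT; apply/andP; split.
  by case: x {xs xside} => y []; rewrite xpair_eqE andbF.
rewrite negb_or xside // andTb andbT; apply/hasPn => _ /mapP[k _ ->].
by apply/mapP => -[].
Qed.

Lemma uniq_sides K T s : uniq s -> uniq (side K true s ++ side T false s).
Proof.
move=> us; have Ns : None \notin map Some s by apply/mapP => -[].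
have := @uniq_cone (None, true) K T s Ns us.
apply: subseq_uniq; apply: subseq_trans (subseq_cons _ _).
exact: cat_subseq (subseq_refl _) (subseq_cons _ _).
Qed.

Notation sletters := (sletter (option I)).
Notation weight2 K T s := (weight (side K true s ++ side T false s)).

(** The hypothesis is [weight_sides] for shorter lists, whose own induction needs the cone over a
    tail. The head of [s] lies at an end of both sides, so [weight_handle] removes it together with
    [x]. *)
Lemma weight_cone x K T s : x.1 \notin map Some s -> uniq s ->
  (forall s', size s' < size s -> uniq s' ->
     weight2 K T s' + (thr_genus (agree K T) s').*2 = weight (Nil sletters))%N ->
  (weight (x :: side K true s ++ inv_letter x :: side T false s)
   + (cone_genus (agree K T) s).*2 = weight (Nil sletters))%N.
Proof.
move=> xs us; have := uniq_cone K T xs us.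
case: s us {xs} => [|k s] /= us u IH.
  by rewrite addn0 weight_cancel.
case/andP: us => _ us.
by rewrite doubleS !addnS -(addnC _.*2) -2!addnS weight_handle // addnC IH.
Qed.

(** If [K] and [T] agree on the head [k], then up to rotation [k] encloses the rest as a cone;
    otherwise its two occurrences are cyclically adjacent and cancel. *)
Lemma weight_sides K T s :
  uniq s ->
  (weight2 K T s + (thr_genus (agree K T) s).*2 = weight (Nil sletters))%N.
Proof.
elim: {s}(size s).+1 {-2}s (ltnSn (size s)) => // n IH [|k s] /= sn us.
  by rewrite addn0.
have IHs s' : (size s' < n -> uniq s' ->
    weight2 K T s' + (thr_genus (agree K T) s').*2 = weight (Nil sletters))%N by exact: IH.
have [ks us'] := andP us.
(* The value [e = false] serves the case where [k] ends both sides: there the rotation puts the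
   inverse letter first. *)
have cone e : (weight ((Some k, e) :: side K true s ++ (Some k, ~~ e) :: side T false s)
   + (cone_genus (agree K T) s).*2 = weight (Nil sletters))%N.
  have kNs : Some k \notin map Some s by rewrite mem_map // => ? ? [].
  apply: (@weight_cone (Some k, e)) => // s' s's; apply: IHs.
  exact: leq_trans s's (ltnW sn).
have IHk := IHs s sn us'.
have uWV := uniq_sides K T us'.
have := @uniq_sides K T (k :: s) us; rewrite /= /ext [in X in _ -> X]inE.
set W := side K true s; set V := side T false s.
set x := (Some k, true); set x' := (Some k, false).
case: (k \in K) (k \in T) => [] [] u /=.
- exact: (cone true).
- have e : x :: W ++ rcons V x' = (x :: W ++ V) ++ [:: x'].
    by rewrite cats1 rcons_cons rcons_cat.
  have {}u : uniq ((x :: W ++ V) ++ [:: x']) by rewrite -e.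
  rewrite e weight_rot //; rewrite uniq_catC in u.
  by rewrite (@weight_cancel _ x').
- rewrite cat_rcons in u *; rewrite weight_rot //; rewrite uniq_catC in u.
  by rewrite weight_cancel // weight_rot // uniq_catC.
have e : rcons W x ++ rcons V x' = (W ++ x :: V) ++ [:: x'].
  by rewrite cats1 -rcons_cat cat_rcons.
rewrite e in u *; rewrite weight_rot //; exact: (cone false).
Qed.
End Sides.

(** * Vertices as cycles *)

Lemma cyc_next (T : finType) (s : seq T) : uniq s -> cyc s =1 next s.
Proof.
move=> us x; have [xs|xs] := boolP (x \in s); last first.
  by rewrite cyc_out // next_nth (negPf xs).
have cyc_rot i : cyc (rot i s) = cyc s.
  elim: i => [|i <-]; first by rewrite rot0.
  have [ils|] := ltnP i (size s); last first.
    by move=> si; rewrite !rot_oversize // ltnW.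
  rewrite rotS //.
  have : uniq (rot i s) by rewrite rot_uniq.
  by case: (rot i s) => // y t uyt; rewrite rot1_cons cyc_rcons.
have [i t def_s] := rot_to xs.
rewrite -(next_rot i us) -(cyc_rot i) def_s.
have uxt : uniq (x :: t) by rewrite -def_s rot_uniq.
rewrite cyc_cons // permM cyc_out ?tpermL; last by case/andP: uxt.
by case: (t) => [|y t'] /=; rewrite eqxx.
Qed.

Section Vertices.
Variables (L : finType) (w : seq (sletter L)).
Hypotheses (uw : uniq w) (w_full : forall x, x \in w).

Let h (i : 'I_(size w)) := tnth (in_tuple w) i.
Let phi := @inv_perm L * cyc w.

Let h_inj : injective h.
Proof. by apply/tuple_uniqP. Qed.

Let h_ordS i : h (ordS i) = cyc w (h i).
Proof.
rewrite (cyc_next uw) /h !(tnth_nth (h i)) /=.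
have iw := ltn_ord i; rewrite next_nth mem_nth // index_uniq //.
move: (h i) (nat_of_ord i) iw; case: (w) => //= y s x k ks.
have [lt|ge] := ltnP k (size s).
  by rewrite modn_small //=; exact: set_nth_default.
have -> : k = size s by apply/eqP; rewrite eqn_leq ge -ltnS ks.
by rewrite modnn /= nth_default.
Qed.

(** Corner [i] is the start of side [i]. If [i] is glued to [j], then [phi] sends side [i] to side
    [ordS j], so an elementary identification of corners is one step of [phi], forwards or
    backwards. *)
Let connectE u v : connect (@corner_glued L w) u v = (h v \in porbit phi (h u)).
Proof.
have phiE x : phi x = cyc w (inv_letter x) by rewrite permM inv_permE.
have glue_phi i j : glued i j -> h (ordS j) = phi (h i).
  by move=> /eqP e; rewrite h_ordS phiE -e.
have gluedC i j : @glued L w i j -> glued j i.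
  by move=> /eqP e; rewrite /glued e inv_letterK.
apply/idP/idP.
  case/connectP => p; elim: p u => [|u' p IH] u /=.
    by move=> _ ->; apply: porbit_id.
  case/andP=> /existsP[i /existsP[j /andP[gl uv]]] /IH{}IH /IH.
  suff /eqP -> : porbit phi (h u') == porbit phi (h u) by [].
  rewrite eq_porbit_mem; case/orP: uv => /andP[/eqP-> /eqP->].
    by rewrite (glue_phi _ _ gl) -{1}[phi]expg1 mem_porbit.
  by rewrite porbit_sym (glue_phi _ _ (gluedC _ _ gl)) -{1}[phi]expg1 mem_porbit.
case/porbitP => n; elim: n v => [|n IH] v.
  by rewrite expg0 perm1 => /h_inj ->; apply: connect0.
rewrite expgSr permM.
have /(nthP (h u)) [k kw hk] := w_full ((phi ^+ n) (h u)).
have e : h (Ordinal kw) = (phi ^+ n) (h u) by rewrite -hk /h (tnth_nth (h u)).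
have /(nthP (h u)) [l lw hl] := w_full (inv_letter (h (Ordinal kw))).
have gl : glued (Ordinal kw) (Ordinal lw).
  by rewrite /glued -[tnth _ (Ordinal kw)]/(h _) -hl (tnth_nth (h u)).
rewrite -e -(glue_phi _ _ gl) => /h_inj ->.
apply: connect_trans (IH _ e) (connect1 _).
apply/existsP; exists (Ordinal kw); apply/existsP; exists (Ordinal lw).
by rewrite gl !eqxx.
Qed.

Lemma nb_vertices_cycles : nb_vertices w = nb_cycles (@inv_perm L) (cyc w).
Proof.
have csym : connect_sym (@corner_glued L w).
  by move=> u v; rewrite !connectE porbit_sym.
have h_surj x : exists i, h i = x.
  have /(nthP x) [k kw hk] := w_full x.
  by exists (Ordinal kw); rewrite /h (tnth_nth x).
rewrite /nb_vertices /n_comp_mem /nb_cycles -/phi.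
have -> : porbits phi = [set porbit phi (h u) | u in roots (@corner_glued L w)].
  apply/setP => A; apply/imsetP/imsetP => [[x _ ->]|[u _ ->]]; last by exists (h u).
  have [u <-] := h_surj x; exists (root (@corner_glued L w) u); first exact: roots_root.
  by apply/eqP; rewrite eq_porbit_mem -connectE csym connect_root.
rewrite card_in_imset; first by apply: eq_card => u; rewrite !inE andbT.
move=> u v /eqP ru /eqP rv /eqP; rewrite eq_porbit_mem -connectE csym.
by rewrite -(root_connect csym) ru rv => /eqP.
Qed.
End Vertices.

Local Close Scope group_scope.

(** * Counting subsets *)

Lemma nb_cycles_inv (L : finType) : nb_cycles (inv_perm L) 1%g = #|L|.
Proof.
have orb x y : y \in porbit (inv_perm L) x -> y.1 = x.1.
  case/porbitP => n ->; elim: n => [|n IH]; first by rewrite expg0 perm1.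
  by rewrite expgSr permM inv_permE.
rewrite /nb_cycles mulg1 -[RHS]cardsT.
suff -> : porbits (inv_perm L) = [set porbit (inv_perm L) (x, true) | x in [set: L]].
  by apply: card_in_imset => x y _ _ /eqP; rewrite eq_porbit_mem => /orb.
apply/setP => A; apply/imsetP/imsetP => [[[x b] _ ->]|[x _ ->]]; last first.
  by exists (x, true).
exists x => //; apply/eqP; rewrite eq_porbit_mem; case: b; first exact: porbit_id.
by have := mem_porbit (inv_perm L) 1 (x, true); rewrite expg1 inv_permE.
Qed.

Lemma ladder_sides n (K T : {set 'I_n}) (s := rev (enum 'I_n)) :
  ladder K T = (None, true) :: side K true s ++ (None, false) :: side T false s.
Proof.
have e (A : {set 'I_n}) : enum A = [seq k <- enum 'I_n | k \in A].
  by rewrite {1}/enum_mem enumT.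
have eC (A : {set 'I_n}) : enum (~: A) = [seq k <- enum 'I_n | k \notin A].
  by rewrite e; apply: eq_filter => k; rewrite in_setC.
by rewrite /ladder !side_filter !eC !e !filter_rev !revK -!catA.
Qed.

Lemma has_genus_ladder n (K T : {set 'I_n}) g :
  has_genus (ladder K T) g = (cone_genus (agree K T) (rev (enum 'I_n)) == g).
Proof.
set s := rev (enum 'I_n).
have us : uniq s by rewrite rev_uniq enum_uniq.
have Ns : None \notin map Some s by apply/mapP => -[].
have u : uniq (ladder K T) by rewrite ladder_sides; apply: (@uniq_cone _ (None, true)).
have full x : x \in ladder K T.
  rewrite ladder_sides inE mem_cat inE !(perm_mem (perm_side _ _ _)).
  have inS k e : (Some k, e) \in [seq (Some k, e) | k <- s].
    by apply/mapP; exists k; rewrite // mem_rev mem_enum.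
  by case: x => -[k|] []; rewrite ?inS ?eqxx ?orbT.
have nbE : nb_edges (ladder K T) = n.+1.
  rewrite /nb_edges /letters -(card_uniqP (undup_uniq _)).
  rewrite -[in RHS](card_ord n) -card_option.
  apply: eq_card => x; rewrite mem_undup; apply/mapP.
  by exists (x, true); first exact: full.
(* All letters occur, so the weight of the ladder is its number of vertices. The empty word has
   weight [n.+2]: one cycle per letter and the vertex of the sphere. *)
have nbV : (nb_vertices (ladder K T) + (cone_genus (agree K T) s).*2 = n.+2)%N.
  rewrite nb_vertices_cycles //.
  have := @weight_cone _ (None, true) K T s Ns us (fun s' _ => @weight_sides _ K T s').
  rewrite -[_ :: _ ++ _](ladder_sides K T) /weight addn0.
  by rewrite [cyc [::]]/cyc nb_cycles_inv card_option card_ord addn1.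
rewrite /has_genus /euler_char nbE; apply/eqP/eqP; lia.
Qed.

Section Counting.
Variable I : finType.
Implicit Types (k : I) (s : seq I) (C D : {set I}).

Definition toggle k C : {set I} := if k \in C then C :\ k else k |: C.

Lemma in_toggle k C x : (x \in toggle k C) = (x == k) (+) (x \in C).
Proof.
rewrite /toggle; have [kC|kC] := boolP (k \in C); rewrite !inE.
  by have [->|] := eqVneq x k; rewrite ?kC.
by have [->|] := eqVneq x k; rewrite ?(negPf kC).
Qed.

Lemma toggleK k : involutive (toggle k).
Proof. by move=> C; apply/setP => x; rewrite !in_toggle addKb. Qed.

Lemma card_toggle_inv k (P : pred {set I}) (b : bool) :
    (forall C, P (toggle k C) = P C) ->
  #|[set C : {set I} | ((k \in C) == b) && P C]|.*2 = #|[set C : {set I} | P C]|.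
Proof.
move=> Pk; rewrite -addnn.
rewrite -(cardsID [set C : {set I} | (k \in C) == b] [set C : {set I} | P C]).
have -> : [set C : {set I} | P C] :&: [set C : {set I} | (k \in C) == b]
        = [set C : {set I} | ((k \in C) == b) && P C].
  by apply/setP => C; rewrite !inE andbC.
congr (_ + _); rewrite -(card_preimset _ (inv_inj (toggleK k))).
apply: eq_card => C; rewrite !inE in_toggle eqxx Pk.
by case: (k \in C); case: b.
Qed.

Lemma eq_thr_genus C D s :
  {in s, C =i D} -> thr_genus C s = thr_genus D s.
Proof.
elim: {s}(size s).+1 {-2}s (ltnSn (size s)) => // m IH [|k [|j s]] //= sm CD.
  by rewrite CD ?inE.
have sub x : x \in j :: s -> (x \in C) = (x \in D).
  by move=> xs; apply: CD; rewrite inE xs orbT.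
have /= -> := IH (j :: s) sm sub; rewrite CD ?mem_head // (IH s) //.
  by rewrite -ltnS ltnW.
by move=> x xs; apply: sub; rewrite inE xs orbT.
Qed.

(** This is [u m g], the number of subsets of [m] letters with threshold genus [g]. A first letter
    outside the subset is dropped; one inside is dropped together with the second letter, which is
    free and gives the factor 2. *)
Fixpoint thr_count (m g : nat) : nat :=
  match m with
  | 0 => g == 0
  | m1.+1 => if m1 is m2.+1
             then thr_count m1 g + 2 * (if g is g'.+1 then thr_count m2 g' else 0)
             else 2 * (g == 0)
  end.

(** Here [C] ranges over the subsets of [I], and the powers of 2 account for the free letters
    outside [s]. After splitting on [k \in C], [card_toggle_inv] applies because the genus of a tail
    does not depend on [k]. *)
Lemma card_thr_genus s (g : nat) : uniq s ->
  #|[set C : {set I} | thr_genus C s == g]| * 2 ^ size s =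
  2 ^ #|I| * thr_count (size s) g.
Proof.
have card0 h : #|[set C : {set I} | 0 == h]| = 2 ^ #|I| * (h == 0).
  rewrite eq_sym; case: (h == 0); rewrite ?muln1 ?muln0.
    by rewrite -[#|I|]cardsT -card_powerset; apply: eq_card => C; rewrite !inE subsetT.
  by apply: eq_card0 => C; rewrite inE.
elim: {s}(size s).+1 {-2}s g (ltnSn (size s)) => // m IH [|k [|j s]] g.
- by move=> _ _; rewrite expn0 muln1.
- move=> _ _; rewrite /= expn1 mulnCA mulnC -card0; congr (_ * _).
  by apply: eq_card => C; rewrite !inE; case: (k \in C).
move=> sm ukjs; have [kjs ujs] := andP ukjs.
have ks : k \notin s by apply: contra kjs; rewrite inE orbC => ->.
have us : uniq s by case/andP: ujs.
have inv (t : seq I) h : k \notin t ->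
    forall C, (thr_genus (toggle k C) t == h) = (thr_genus C t == h).
  move=> kt C; rewrite (@eq_thr_genus _ C) // => x xt.
  by rewrite in_toggle; case: eqP xt kt => // -> ->.
have sm1 : size (j :: s) < m by [].
have sm2 : size s < m by rewrite ltnW.
rewrite -[thr_count _ _]/(thr_count (size (j :: s)) g +
  2 * (if g is g'.+1 then thr_count (size s) g' else 0)).
rewrite mulnDr -(IH (j :: s) g sm1 ujs) -(card_toggle_inv false (inv (j :: s) g kjs)).
have -> : 2 ^ #|I| * (2 * (if g is g'.+1 then thr_count (size s) g' else 0)) =
    #|[set C : {set I} | (k \in C) && ((thr_genus C s).+1 == g)]| *
    2 ^ size [:: k, j & s].
  case: g => [|g].
    by rewrite !muln0 eq_card0 // => C; rewrite inE andbF.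
  rewrite mulnCA -(IH s g sm2 us) -(card_toggle_inv true (inv s g ks)) /= !expnS.
  set A := #|_|; set B := #|_|; suff -> : B = A by lia.
  by apply: eq_card => C; rewrite !inE; case: (k \in C).
rewrite -(cardsID [set C : {set I} | k \in C]) mulnDl addnC.
congr (_ + _).
  rewrite -muln2 -mulnA -expnS; congr (_ * _); apply: eq_card => C.
  by rewrite !inE /=; case: (k \in C).
by congr (_ * _); apply: eq_card => C; rewrite !inE /= andbC; case: (k \in C).
Qed.

End Counting.

Lemma genus_count0 n : 0 < n -> genus_count n 0 = 0.
Proof.
case: n => // n _; apply: eq_card0 => KT; rewrite !inE has_genus_ladder.
have : size (rev (enum 'I_n.+1)) = n.+1 by rewrite size_rev size_enum_ord.
by case: (rev _).
Qed.

Lemma genus_countS n g : genus_count n.+1 g.+1 = 2 ^ n.+2 * thr_count n g.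
Proof.
set s := rev (enum 'I_n.+1).
have us : uniq s by rewrite rev_uniq enum_uniq.
have : size s = n.+1 by rewrite size_rev size_enum_ord.
rewrite /genus_count; case def_s: s us => [|k t] //= /andP[_ ut] [st].
(* Replacing [T] by the agreement set is a bijection on pairs. Then [K] is free, and so is the
   membership of [k] in that set, whence the exponent [n.+2]. *)
pose f (KT : {set 'I_n.+1} * {set 'I_n.+1}) := (KT.1, agree KT.1 KT.2).
have fK : involutive f.
  case=> K T; congr pair; apply/setP => x; rewrite !inE /=.
  by case: (x \in K); case: (x \in T).
have -> : [set KT : {set 'I_n.+1} * {set 'I_n.+1} | has_genus (ladder KT.1 KT.2) g.+1]
        = f @^-1: setX setT [set C : {set 'I_n.+1} | thr_genus C t == g].
  by apply/setP => -[K T]; rewrite !inE has_genus_ladder -/s def_s /=.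
rewrite card_preimset; last exact: inv_inj.
have := card_thr_genus g ut; rewrite card_ord st => e.
apply/eqP; rewrite -(eqn_pmul2r (expn_gt0 2 n : 0 < _)).
rewrite cardsX -mulnA e -powersetT card_powerset cardsT card_ord.
by apply/eqP; rewrite !expnS; lia.
Qed.

(** * Shape of the distribution *)

Lemma thr_countSS m g :
  thr_count m.+2 g.+1 = thr_count m.+1 g.+1 + 2 * thr_count m g.
Proof. by []. Qed.

Lemma thr_countS0 m : thr_count m.+1 0 = 2.
Proof.
by elim: m => // m; rewrite -[thr_count m.+2 0]/(thr_count m.+1 0 + 2 * 0) => ->.
Qed.

Lemma thr_count_eq0 m g : (thr_count m g == 0) = (m < g.*2).
Proof.
elim: {m}m.+1 {-2}m (ltnSn m) g => // N IH [|[|m]] mN [|g] //.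
  by rewrite thr_countS0.
by rewrite thr_countSS addn_eq0 muln_eq0 !IH //; lia.
Qed.

Lemma thr_count_diag g : thr_count g.*2 g = 2 ^ g.
Proof.
elim: g => // g IH; rewrite doubleS thr_countSS IH expnS.
by have /eqP -> : thr_count g.*2.+1 g.+1 == 0 by rewrite thr_count_eq0; lia.
Qed.

(* The closed formula of the header for [m = 2 g + d], with the denominators
   cleared. *)
Lemma thr_count_fact (g d : nat) :
  thr_count (g.*2 + d) g * (g`! * d`! * (g + d)) = 2 ^ g * ((g + d)`! * (g + d.*2)).
Proof.
elim: g d => [|g IHg] d.
  by case: d => // d; rewrite !add0n thr_countS0 fact0; lia.
elim: d => [|d IHd].
  by rewrite !addn0 thr_count_diag fact0 muln1.
rewrite doubleS addnS !addSn thr_countSS.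
have {IHg} := IHg d.+1; move: IHd.
rewrite doubleS expnS -!addnn !addSn !addnS !factS.
move: (thr_count _ _) (thr_count _ _) (g`!) (d`!) (2 ^ g) ((g + d)`!).
move=> A B G D E F IHd IHg.
(* The additional factor [(g + d).+1] makes both induction hypotheses appear literally. *)
have e : (B + 2 * A) * (g.+1 * G * (d.+1 * D) * (g + d).+2) * (g + d).+1
   = (g + d).+2 * (d.+1 * (B * (g.+1 * G * D * (g + d).+1)) +
                   2 * g.+1 * (A * (G * (d.+1 * D) * (g + d).+1))) by ring.
apply/eqP; rewrite -(eqn_pmul2r (ltn0Sn (g + d))) e IHd IHg; apply/eqP; ring.
Qed.

(** The ratio of consecutive terms for [m = 2 g + d + 2], cross-multiplied: the closed formula at
    [(g, d.+2)] is compared with the one at [(g.+1, d)]. *)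
Lemma thr_count_ratio (g d : nat) :
  g.+1 * (g + d + 1) * (g + d.*2 + 4) * thr_count (g.*2 + d.+2) g.+1 =
  2 * d.+2 * d.+1 * (g + d.*2 + 1) * thr_count (g.*2 + d.+2) g.
Proof.
have := thr_count_fact g d.+2; have := thr_count_fact g.+1 d.
rewrite !doubleS expnS -!addnn !addSn !addnS !factS !addn0.
have := fact_gt0 g; have := fact_gt0 d.
move: (thr_count _ _) (thr_count _ _) (g`!) (d`!) (2 ^ g) ((g + d)`!).
move=> A B G D E F D0 G0 hB hA.
have GD0 : 0 < G * D * (g + d).+2 by rewrite !muln_gt0 G0 D0.
apply/eqP; rewrite -(eqn_pmul2r GD0); apply/eqP.
transitivity ((g + (d + d)).+4 * (g + d).+2 * (B * (g.+1 * G * D * (g + d).+1))).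
  by ring.
rewrite hB; transitivity (2 * (g + (d + d)).+1 *
    (A * (G * (d.+2 * (d.+1 * D)) * (g + d).+2))); last by ring.
by rewrite hA; ring.
Qed.

Lemma thr_count_log_concave m g :
  thr_count m g * thr_count m g.+2 <= thr_count m g.+1 ^ 2.
Proof.
have [mg|gm] := ltnP m g.+2.*2.
  by have /eqP -> : thr_count m g.+2 == 0; rewrite ?thr_count_eq0 ?muln0.
(* With this [d], the ratios at [g] and at [g.+1] concern the same [m]. *)
pose d := m - g.+2.*2.
have e0 := thr_count_ratio g d.+2; have e1 := thr_count_ratio g.+1 d.
have em0 : g.*2 + d.+4 = m by lia.
have em1 : g.+1.*2 + d.+2 = m by lia.
rewrite em0 in e0; rewrite em1 in e1.
have : (g.+1 * (g + d.+2 + 1) * (g + d.+2.*2 + 4)) *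
         (2 * d.+2 * d.+1 * (g.+1 + d.*2 + 1))
    <= (2 * d.+4 * d.+3 * (g + d.+2.*2 + 1)) *
         (g.+2 * (g.+1 + d + 1) * (g.+1 + d.*2 + 4)).
  (* Each of the three factors of the ratio of consecutive terms decreases. *)
  have le1 : g.+1 * d.+2 <= g.+2 * d.+4 by nia.
  have le2 : (g + d.+2 + 1) * d.+1 <= d.+3 * (g.+1 + d + 1) by nia.
  have le3 : (g + d.+2.*2 + 4) * (g.+1 + d.*2 + 1)
    <= (g + d.+2.*2 + 1) * (g.+1 + d.*2 + 4) by nia.
  have := leq_mul (leqnn 2) (leq_mul (leq_mul le1 le2) le3).
  rewrite -!addnn => le; apply: leq_trans (leq_trans _ le) _; apply: eq_leq; ring.
move: e0 e1; set P := g.+1 * _ * _; set Q := 2 * d.+4 * _ * _; set R := g.+2 * _ * _.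
set S := 2 * d.+2 * _ * _.
have Q0 : 0 < Q by rewrite !muln_gt0 addn1.
have R0 : 0 < R by rewrite !muln_gt0 addn1 addn4.
move: (thr_count _ _) (thr_count _ _) (thr_count _ _) => y x z hx hy PSQR.
have QR0 : 0 < Q * R by rewrite muln_gt0 Q0.
rewrite -(leq_pmul2r QR0).
suff -> : x * y * (Q * R) = P * S * z ^ 2 by rewrite [leqRHS]mulnC leq_mul2r PSQR orbT.
transitivity ((Q * x) * (R * y)); first by ring.
by rewrite -hx hy; ring.
Qed.

Lemma ltn_of_ratio p q x y : p * y = q * x -> p < q -> 0 < x -> x < y.
Proof.
move=> e pq x0; rewrite ltnNge; apply/negP => yx.
have : p * y <= p * x by rewrite leq_mul2l yx orbT.
by rewrite e leqNgt ltn_pmul2r // pq.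
Qed.

Lemma thr_count_before_mode m g : m.+1 %/ 3 = g.+1 -> m != 2 ->
  thr_count m g < thr_count m g.+1.
Proof.
move=> mg m2.
have [d e] : exists d, m = g.*2 + d.+2 by exists (m - g.*2.+2); lia.
rewrite e; apply: ltn_of_ratio (thr_count_ratio g d) _ _; last first.
  by rewrite lt0n thr_count_eq0; lia.
(* The quotient gives [3 g + 3 <= m + 1 <= 3 g + 5]. For [d = g] the two coefficients differ by
   [3 g (g + 1)], which vanishes only for [m = 2]: this is the tie at [n = 3]. *)
have : [|| d == g, d == g.+1 | d == g.+2] by lia.
case/or3P=> /eqP dE; rewrite dE in e *; nia.
Qed.

Lemma thr_count_after_mode m g : m.+1 %/ 3 = g -> g.*2 <= m ->
  thr_count m g.+1 < thr_count m g.
Proof.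
move=> mg gm; have u0 : 0 < thr_count m g by rewrite lt0n thr_count_eq0; lia.
have [mlt|mge] := ltnP m g.+1.*2.
  by have /eqP -> : thr_count m g.+1 == 0 by rewrite thr_count_eq0.
have [d e] : exists d, m = g.*2 + d.+2 by exists (m - g.*2.+2); lia.
have u1 : 0 < thr_count m g.+1 by rewrite lt0n thr_count_eq0; lia.
move: u1; rewrite e; apply: ltn_of_ratio (esym (thr_count_ratio g d)) _.
(* Now [3 g <= m + 1 <= 3 g + 2] with [m = 2 g + d + 2]. *)
have : [|| g == d.+1, g == d.+2 | g == d.+3] by lia.
case/or3P=> /eqP dE; rewrite dE; nia.
Qed.

(** For positive terms log-concavity makes [f i.+1 / f i] nonincreasing, so the rise into [l]
    propagates to the left and the drop after [m] to the right. *)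
Lemma log_concave_unimodal q r l m f :
    (forall i, q <= i <= r -> 0 < f i) -> log_concave q r f ->
    [&& q <= l, l <= m & m <= r] ->
    (q < l -> f l.-1 < f l) -> (forall i, l <= i <= m -> f i = f l) ->
    (m < r -> f m.+1 < f m) ->
  unimodal_with_modes q r l m f.
Proof.
move=> f_gt0 f_lc qlmr up flat down; have /and3P[ql lm mr] := qlmr.
have lcS i : q <= i -> i.+1 < r -> f i * f i.+2 <= f i.+1 * f i.+1.
  by move=> qi ir; apply: (f_lc i.+1); rewrite ltnS qi.
split=> //; last split=> //.
- have le j i : q <= i -> i + j.+1 = l -> f i <= f i.+1.
    elim: j i => [|j IH] i qi def_l.
      by rewrite addn1 in def_l; rewrite -[i]/(i.+1.-1) def_l ltnW // up -?def_l.
    have := lcS i qi; have := IH i.+1; have := f_gt0 i.+2; have := f_gt0 i.+1.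
    nia.
  by move=> i qi il; apply: (le (l - i.+1)) => //; lia.
have ge j : m + j < r -> f (m + j).+1 <= f (m + j).
  elim: j => [|j IH] jr; first by rewrite addn0 in jr *; rewrite ltnW // down.
  have := lcS (m + j); have := f_gt0 (m + j); have := f_gt0 (m + j).+1.
  rewrite addnS in jr *; have := IH (ltnW jr); nia.
by move=> i mi ir; have := ge (i - m); rewrite (subnKC (ltnW mi)); apply.
Qed.

Lemma genus_countE n g :
  0 < n -> genus_count n g = if g is g'.+1 then 2 ^ n.+1 * thr_count n.-1 g' else 0.
Proof. by case: n => // n _; case: g => [|g]; rewrite ?genus_count0 ?genus_countS. Qed.

Theorem corollary3p4 (n : nat) (hn : 1 <= n) :
  exists q r : nat,
    [/\ genus_range n q r,
        log_concave q r (genus_count n),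
        n = 3 -> unimodal_with_modes q r 1 2 (genus_count n) &
        n <> 3 ->
          unimodal_with_modes q r (n %/ 3 + 1) (n %/ 3 + 1) (genus_count n)].
Proof.
(* Genus [g.+1] occurs exactly when [g.*2 <= n.-1]: each unit of genus after the first uses two
   letters. *)
exists 1, n.-1./2.+1.
have gt0 i : (0 < genus_count n i) = (1 <= i <= n.-1./2.+1).
  rewrite genus_countE //; case: i => // i.
  by rewrite muln_gt0 expn_gt0 /= lt0n thr_count_eq0 -leqNgt; lia.
have lc : log_concave 1 n.-1./2.+1 (genus_count n).
  case=> [|[|i]] //= _; rewrite !genus_countE // expnMn mulnACA mulnn.
  by rewrite leq_mul2l thr_count_log_concave orbT.
have gt0' i : 1 <= i <= n.-1./2.+1 -> 0 < genus_count n i by rewrite gt0.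
split=> //.
- by split=> [||i]; rewrite gt0; lia.
- move=> n3; apply: log_concave_unimodal => //; first by rewrite n3.
  + by case=> [|[|[|i]]] //= _; rewrite n3 !genus_countE.
  + by rewrite n3.
(* Here [thr_count] is taken at [m = n.-1], so [m.+1 %/ 3] is [n %/ 3], and the genus is larger by
   one. *)
move=> n3; rewrite addn1; apply: log_concave_unimodal => //=; first by lia.
- case E : (n %/ 3) => [|t] // _; rewrite !genus_countE // ltn_pmul2l ?expn_gt0 //.
  by apply: thr_count_before_mode; rewrite ?prednK //; lia.
- by move=> i; rewrite -eqn_leq => /eqP ->.
move=> _; rewrite !genus_countE // ltn_pmul2l ?expn_gt0 //.
by apply: thr_count_after_mode; rewrite ?prednK //; lia.
Qed.
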